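(* Let $X$ be a nonempty compact metric space, let $f:X\to X$ be a continuous map, and suppose that $(X,f)$ has the strict approximate product property. Then the following are equivalent: (1) $(X,f)$ is minimal, i.e. for every $x\in X$ the forward orbit $\{f^n(x):n\ge 0\}$ is dense in $X$. (2) $(X,f)$ is uniquely ergodic, i.e. it has exactly one $f$-invariant Borel probability measure. (3) $(X,f)$ has zero topological entropy.
   Context: A system $(X,f)$ is a compact metric space $(X,d)$ with a continuous map $f:X\to X$ (not necessarily invertible). $\mathbb{Z}^+$ denotes the set of positive integers, and $\mathbb{Z}_n:=\{0,1,\dots,n-1\}$ for $n\in\mathbb{Z}^+$. Tracing. Let $\mathscr{C}=\{x_k\}_{k\in\mathbb{Z}^+}$ be a sequence in $X$ and let $\mathscr{S}=\{m_k\}_{k\in\mathbb{Z}^+}$, $\mathscr{G}=\{t_k\}_{k\in\mathbb{Z}^+}$ be sequences of positive integers. Put $s_1:=0$ and $s_k:=\sum_{i=1}^{k-1}(m_i+t_i-1)$ for $k\ge 2$. For real $\delta\ge 0$, $\varepsilon>0$ and $z\in X$, the triple $(\mathscr{C},\mathscr{S},\mathscr{G})$ is $(\delta,\varepsilon)$-traced by $z$ if for every $k\in\mathbb{Z}^+$, $$\left|\left\{j\in\mathbb{Z}_{m_k}: d(f^{s_k+j}(z),f^j(x_k))>\varepsilon\right\}\right|\le \delta m_k.$$ In particular, $(0,\varepsilon)$-traced means $d(f^{s_k+j}(z),f^j(x_k))\le\varepsilon$ for all $k\in\mathbb{Z}^+$ and all $j\in\mathbb{Z}_{m_k}$. Strict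 approximate product property. $(X,f)$ has the strict approximate product property if for all $\delta,\varepsilon>0$ there is $M=M(\delta,\varepsilon)>0$ such that for every integer $n>M$ and every sequence $\mathscr{C}$ in $X$ there are a sequence $\mathscr{G}=\{t_k\}_{k\in\mathbb{Z}^+}$ of positive integers with $t_k\le 1+\delta n$ for all $k$ and a point $z\in X$ such that $(\mathscr{C},\{n\}^{\mathbb{Z}^+},\mathscr{G})$ is $(0,\varepsilon)$-traced by $z$, where $\{n\}^{\mathbb{Z}^+}$ is the constant sequence $n$. *)

(* Defs.v *)
From HB Require Import structures.
From mathcomp Require Import all_boot all_order all_algebra finmap.
From mathcomp Require Import all_classical all_reals all_analysis.

Set Implicit Arguments.
Unset Strict Implicit.
Unset Printing Implicit Defensive.

Import Order.TTheory GRing.Theory Num.Theory.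
Import numFieldNormedType.Exports.

Local Open Scope classical_set_scope.
Local Open Scope ring_scope.

(* MathComp-Analysis measurable types are pointed, so a nonempty metric space
   is taken with a distinguished point; nothing below depends on the choice of
   that point. *)
#[short(type="pmetricType")]
HB.structure Definition PointedMetric (K : numDomainType) :=
  {T of Pointed T & Metric K T}.

Notation borel X := (g_sigma_algebraType (@open X)).

Section Dynamics.
Context {R : realType} {X : pmetricType R}.
Implicit Types (f : X -> X) (n : nat) (eps delta : R).

(* All sequences are indexed from 0 instead of 1. The subtraction is the
   truncated one of nat, which is exact here since t i > 0. *)
Definition trace_start (m t : nat -> nat) (k : nat) : nat :=
  (\sum_(i < k) (m i + t i - 1))%N.

Definition traced f delta eps (C : nat -> X) (m t : nat -> nat) (z : X) :=
  forall k : nat,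
    #|[pred j : 'I_(m k) |
        eps < mdist (iter (trace_start m t k + j) f z) (iter j f (C k))]|%:R
    <= delta * (m k)%:R.

Definition strict_approximate_product_property f :=
  forall delta eps, 0 < delta -> 0 < eps ->
  exists2 M : R, 0 < M &
  forall n, M < n%:R ->
  forall C : nat -> X,
  exists (t : nat -> nat) (z : X),
    (forall k, (0 < t k)%N /\ (t k)%:R <= 1 + delta * n%:R) /\
    traced f 0 eps C (fun=> n) t z.

Definition minimal_system f :=
  forall x : X, dense (range (fun n => iter n f x)).

Definition invariant_measure f (mu : probability (borel X) R) :=
  forall A : set (borel X), measurable A -> mu (f @^-1` A) = mu A.

(* An element of [probability (borel X) R] is a function on all subsets of X, so
   [exists!] would also compare values on non-Borel sets. *)
Definition uniquely_ergodic f :=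
  (exists mu : probability (borel X) R, invariant_measure f mu) /\
  (forall mu nu : probability (borel X) R,
     invariant_measure f mu -> invariant_measure f nu ->
     forall A : set (borel X), measurable A -> mu A = nu A).

Definition separated f n eps (E : {fset X}) :=
  forall x y : X, x \in E -> y \in E -> x != y ->
  exists2 j : nat, (j < n)%N & eps < mdist (iter j f x) (iter j f y).

Definition separated_card f n eps : \bar R :=
  ereal_sup [set (#|` E|%fset)%:R%:E | E in separated f n eps].

(* Bowen's definition; for n = 0 the quotient is 0 by convention, which does
   not affect the limsup. *)
Definition entropy_at_scale f eps : \bar R :=
  limn_esup (fun n => (n%:R^-1)%:E * lne (separated_card f n eps))%E.

(* The limit exists in \bar R: [entropy_at_scale f] is nonincreasing. *)
Definition topological_entropy f : \bar R :=
  lim (entropy_at_scale f eps @[eps --> 0^'+]).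

End Dynamics.

(* Main.v *)
(* The three properties are proved in a cycle.
   (2) => (1): if the orbit of x avoids a ball around y, the empirical measures
   of x accumulate on an invariant measure that does not charge this ball, while
   a point tracing y, y, y, ... visits it with positive lower density and so
   yields an invariant measure that does.
   (1) => (3): let z trace the constant sequence y with blocks of length n and
   gaps of length at most delta * n.  By minimality the orbit of z shadows every
   finite orbit segment, and a window of length N of the orbit of z is
   determined, up to a small error, by its phase and by the cells of a finite
   cover visited in the gaps.  This gives about C ^ (delta * N) windows, and
   delta is arbitrary.
   (3) => (2): if two invariant measures differ on an open set, there are points
   x and y whose length-n orbit segments visit this set with different
   frequencies.  Tracing the 4 ^ N words of length 2 N in x and y gives points
   that are separated unless the gaps shift the blocks by different amounts; the
   shifts, rounded to multiples of h (at least twice the largest gap) and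
   recorded every second letter, take at most 2 ^ N values, so 2 ^ N separated
   points remain.
   Existence of invariant measures is the Krylov-Bogoliubov theorem; the measure
   comes from the limit of the visit frequencies along an ultrafilter. *)
From HB Require Import structures.
Require Import Defs.
From mathcomp Require Import all_boot all_order all_algebra finmap.
From mathcomp Require Import all_classical all_reals all_analysis.
From mathcomp Require Import measurable_realfun zify ring lra.

Set Implicit Arguments.
Unset Strict Implicit.
Unset Printing Implicit Defensive.

Import Order.TTheory GRing.Theory Num.Theory.
Import numFieldNormedType.Exports.

Local Open Scope classical_set_scope.
Local Open Scope ring_scope.

(** * Regular Borel measures from contents on a compact metric space *)

Lemma probability_of_measure d (T : measurableType d) (R : realType)
    (m : {measure set T -> \bar R}) : m setT = 1%E ->
  exists P : probability T R, forall A, P A = m A.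
Proof.
move=> m1; have mE : mnormalize m (dirac point) = m :> (set T -> \bar R).
  by apply/funext => A; rewrite /mnormalize m1 onee_eq0/= invr1 mule1.
exists (mnormalize m (dirac point)) => A; exact: (congr1 (@^~ A) mE).
Qed.

Section content.
Context {R : realType} {X : pmetricType R}.
Variable nu : set X -> R.
Hypothesis compactX : compact [set: X].
Hypothesis nu_ge0 : forall A, 0 <= nu A.
Hypothesis nuT : nu setT = 1.
Hypothesis nuU : forall A B, A `&` B = set0 -> nu (A `|` B) = nu A + nu B.

Local Open Scope ereal_scope.

(** [nu] is only finitely additive, so a measure is rebuilt as in the Riesz representation theorem:
    open sets from inside by closed (hence compact) sets, then arbitrary sets from outside by open
    sets. *)
Definition inner_content (U : set X) : \bar R :=
  ereal_sup [set (nu K)%:E | K in [set K | closed K /\ K `<=` U]].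

Definition outer_content (A : set X) : \bar R :=
  ereal_inf [set inner_content U | U in [set U | open U /\ A `<=` U]].

Let le_nu A B : A `<=` B -> (nu A <= nu B)%R.
Proof.
move=> AB; rewrite -(setDUK AB) nuU ?lerDl//.
by rewrite setDE setICA setICr setI0.
Qed.

Let nu0 : nu set0 = 0%R.
Proof. by have /eqP := nuU (setI0 set0); rewrite setU0 -subr_eq subrr => /eqP. Qed.

Let nuU_le A B : (nu (A `|` B) <= nu A + nu B)%R.
Proof.
rewrite -(setDUK (@subsetUl _ A B)) nuU ?lerD2l.
  by apply: le_nu => x [[]].
by rewrite setDE setICA setICr setI0.
Qed.

Let inner_sup K U : closed K -> K `<=` U -> (nu K)%:E <= inner_content U.
Proof. by move=> cK KU; apply: ereal_sup_ubound; exists K. Qed.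

Let le_inner U V : U `<=` V -> inner_content U <= inner_content V.
Proof.
move=> UV; apply: ge_ereal_sup => _ [K [cK KU] <-].
by apply: inner_sup => //; exact: subset_trans UV.
Qed.

Let inner_ge0 U : 0 <= inner_content U.
Proof.
apply: (@le_trans _ _ (nu set0)%:E); first by rewrite nu0.
by apply: inner_sup => //; exact: closed0.
Qed.

Let innerT : inner_content setT = 1.
Proof.
apply/eqP; rewrite eq_le; apply/andP; split.
  by apply: ge_ereal_sup => _ [K [cK KU] <-]; rewrite lee_fin -nuT le_nu.
apply: (@le_trans _ _ (nu setT)%:E); first by rewrite nuT.
by apply: inner_sup => //; exact: closedT.
Qed.

(* By normality a closed subset of [U `|` V] is the union of a closed subset of
   [U] and a closed subset of [V]. *)
Let innerU U V : open U -> open V ->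
  inner_content (U `|` V) <= inner_content U + inner_content V.
Proof.
move=> oU oV; apply: ge_ereal_sup => _ [K [cK KUV] <-].
have [W1 [W2 [oW1 oW2 KW1 KW2 W12]]] : exists W1 W2, [/\ open W1, open W2,
    K `\` U `<=` W1, K `\` V `<=` W2 & W1 `&` W2 = set0].
  apply: (proj1 (@normal_openP R X) (@pseudometric_normal R X)).
  - by apply: closedI => //; exact: open_closedC.
  - by apply: closedI => //; exact: open_closedC.
  - by rewrite -subset0 => x [[Kx nUx] [_ nVx]]; have [] := KUV _ Kx.
have KW12 : K `<=` K `\` W1 `|` K `\` W2.
  move=> x Kx; have [W1x|nW1x] := pselect (W1 x); last by left.
  by right; split=> // W2x; suff: set0 x by []; rewrite -W12.
apply: (@le_trans _ _ (nu (K `\` W1) + nu (K `\` W2))%:E).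
  by rewrite lee_fin (le_trans _ (nuU_le _ _))// le_nu.
rewrite EFinD; apply: leeD; apply: inner_sup.
- by apply: closedI => //; exact: open_closedC.
- by move=> x [Kx nW1]; apply: contrapT => nUx; exact/nW1/KW1.
- by apply: closedI => //; exact: open_closedC.
- by move=> x [Kx nW2]; apply: contrapT => nVx; exact/nW2/KW2.
Qed.

(** A closed [K] in the union is compact, so finitely many [U i] cover it and finite subadditivity
    applies. *)
Let inner_bigcup (U : (set X)^nat) : (forall i, open (U i)) ->
  inner_content (\bigcup_i U i) <= \sum_(i <oo) inner_content (U i).
Proof.
move=> oU.
have fin n : inner_content (\bigcup_(i < n) U i) <=
    \sum_(0 <= i < n) inner_content (U i).
  elim: n => [|n IH].
    rewrite bigcup_mkord big_ord0 big_nil; apply: ge_ereal_sup => _ [K [_ K0] <-].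
    by rewrite (_ : K = set0) ?nu0// -subset0.
  rewrite bigcup_mkord big_ord_recr/= -bigcup_mkord big_nat_recr//=.
  apply: le_trans (innerU _ (oU n)) _; first by apply: bigcup_open => i _.
  by rewrite leeD2r.
apply: ge_ereal_sup => _ [K [cK KU] <-].
have cptK : compact K by apply: subclosed_compact cK compactX _.
move: cptK; rewrite compact_cover => /(_ nat setT U (fun i _ => oU i) KU)[D _ KD].
have [n nD] : exists n, forall i, i \in D -> (i < n)%N.
  exists (\max_(i <- D) i).+1 => i iD.
  by rewrite ltnS (@leq_bigmax_seq _ _ xpredT id).
apply: (@le_trans _ _ (\sum_(0 <= i < n) inner_content (U i))).
  apply: le_trans (fin n); apply: inner_sup => // x /KD[i iD Uix].
  by exists i => //; exact: nD.
exact: nneseries_lim_ge.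
Qed.

Let outer_open U : open U -> outer_content U = inner_content U.
Proof.
move=> oU; apply/eqP; rewrite eq_le; apply/andP; split.
  by apply: ereal_inf_lbound; exists U => //; split.
by apply: le_ereal_inf_tmp => _ [V [oV UV] <-]; exact: le_inner.
Qed.

Let outer0 : outer_content set0 = 0.
Proof.
rewrite outer_open; last exact: open0.
apply/eqP; rewrite eq_le inner_ge0 andbT.
apply: ge_ereal_sup => _ [K [_ K0] <-].
by rewrite (_ : K = set0) ?nu0// -subset0.
Qed.

Let outer_ge0 A : 0 <= outer_content A.
Proof. by apply: le_ereal_inf_tmp => _ [V _ <-]. Qed.

Let le_outer : {homo outer_content : A B / A `<=` B >-> A <= B}.
Proof.
move=> A B AB; apply: le_ereal_inf_tmp => _ [V [oV BV] <-].
by apply: ereal_inf_lbound; exists V => //; split=> //; exact: subset_trans BV.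
Qed.

Let outer_fin A : outer_content A \is a fin_num.
Proof.
rewrite ge0_fin_numE//; apply: (@le_lt_trans _ _ (outer_content setT)).
  exact: le_outer.
by rewrite outer_open ?innerT ?ltry//; exact: openT.
Qed.

Let outer_adherent A (e : R) : (0 < e)%R ->
  exists U, [/\ open U, A `<=` U & inner_content U <= outer_content A + e%:E].
Proof.
move=> e0; have [_ [U [oU AU] <-] Ue] := lb_ereal_inf_adherent e0 (outer_fin A).
by exists U; split=> //; exact: ltW.
Qed.

Let outer_sigma_subadditive : sigma_subadditive outer_content.
Proof.
move=> A; apply/lee_addgt0Pr => e e0.
have pow_gt0 i : (0 < e / (2 ^ i.+1)%:R)%R.
  by rewrite divr_gt0// ltr0n expn_gt0.
have /choice[U UP] := fun i => outer_adherent (A i) (pow_gt0 i).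
apply: le_trans (epsilon_trick xpredT (fun i => outer_ge0 (A i)) (ltW e0)).
apply: (@le_trans _ _ (\sum_(i <oo) inner_content (U i))); last first.
  by apply: lee_nneseries => [i _ _|i _]; [exact: inner_ge0|have [] := UP i].
apply: le_trans (inner_bigcup _); last by move=> i; have [] := UP i.
rewrite -outer_open; last by apply: bigcup_open => i _; have [] := UP i.
by apply: le_outer; apply: subset_bigcup => i _; have [] := UP i.
Qed.

Let mu : {outer_measure set X -> \bar R} := HB.pack outer_content
  (isOuterMeasure.Build R X outer_content outer0 outer_ge0 le_outer
    outer_sigma_subadditive).

(** For open [V] containing [A], take a closed [K] in the part of [V] inside [U], then a closed [L]
    in [V] minus [K]. They are disjoint, so [nu] adds on their union; suprema over [L], then over
    [K], give the Caratheodory inequality. *)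
Let caratheodory_open U : open U -> mu.-caratheodory U.
Proof.
move=> oU; apply: le_caratheodory_measurable => A.
apply: le_ereal_inf_tmp => _ [V [oV AV] <-].
apply: (@le_trans _ _ (inner_content (V `&` U) + mu (V `\` U))).
  apply: leeD.
    by rewrite -outer_open; [apply: le_outer; exact: setSI|exact: openI].
  by apply: le_outer => x [/AV Vx nUx].
rewrite -leeBrDr; last exact: outer_fin.
apply: ge_ereal_sup => _ [K [cK KVU] <-].
rewrite leeBrDr; last exact: outer_fin.
have oVK : open (V `\` K) by apply: openI => //; exact: closed_openC.
apply: (@le_trans _ _ ((nu K)%:E + inner_content (V `\` K))).
  rewrite leeD2l// -outer_open//; apply: le_outer => x [Vx nUx].
  by split=> // /KVU[].
rewrite addeC -leeBrDr//; apply: ge_ereal_sup => _ [L [cL LVK] <-].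
rewrite leeBrDr// -EFinD addrC -nuU; last first.
  by rewrite -subset0 => x [Kx /LVK[]].
apply: inner_sup; first exact: closedU.
by move=> x [/KVU[]|/LVK[]].
Qed.

Let caratheodory_borel (A : set (borel X)) : measurable A -> mu.-caratheodory A.
Proof.
apply: (smallest_sub (@sigma_algebra_measurable _ (caratheodory_type mu))).
exact: caratheodory_open.
Qed.

Let mu0 : mu (set0 : set (borel X)) = 0.
Proof. exact: outer0. Qed.

Let mu_ge0 (A : set (borel X)) : 0 <= mu A.
Proof. exact: outer_ge0. Qed.

Let mu_sigma_additive : semi_sigma_additive (mu : set (borel X) -> \bar R).
Proof.
move=> F mF tF mUF; apply: (@caratheodory_measure_sigma_additive _ _ mu F) => //.
- by move=> i; exact: caratheodory_borel (mF i).
- exact: caratheodory_borel mUF.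
Qed.

Let muT : mu (setT : set (borel X)) = 1.
Proof. by rewrite [LHS]outer_open ?innerT//; exact: openT. Qed.

Lemma regular_probability_of_content : exists P : probability (borel X) R,
  forall U : set X, open U -> P U = inner_content U.
Proof.
pose m : {measure set (borel X) -> \bar R} :=
  HB.pack (mu : set (borel X) -> \bar R)
    (isMeasure.Build _ _ _ (mu : set (borel X) -> \bar R)
      mu0 mu_ge0 mu_sigma_additive).
by have [P Pm] := @probability_of_measure _ _ _ m muT; exists P => U /outer_open <-.
Qed.

End content.

(** * Existence of invariant measures *)

Section ultrafilter_limit.
Context {T : Type} {R : realType}.

(** By compactness the image filter has a cluster point [p]. An ultrafilter contains the preimage of
    a neighbourhood of [p] or its complement, and the complement is excluded by clustering. *)
Lemma ultra_bounded_cvg (G : set_system T) (u : T -> R) (a b : R) :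
  UltraFilter G -> (forall n, a <= u n <= b) -> cvg (u @ G).
Proof.
move=> GU uab.
have Gab : (u @ G) `[a, b]%classic.
  by apply: (@filterE _ G) => n; rewrite /= in_itv/=; exact: uab.
have [p [_ clp]] := @segment_compact R a b (u @ G) _ Gab.
apply/cvg_ex; exists p => B /= Bp.
have [//|GnB] := in_ultra_setVsetC (u @^-1` B) GU.
by have [y [nBy By]] := clp (~` B) B GnB Bp.
Qed.

End ultrafilter_limit.

(** * Visit counts and frequencies along an orbit *)

Section frequency.
Context {R : realType} {T : Type}.
Implicit Types (f : T -> T) (A B : set T) (N : nat).

Definition visits f x A N : nat := \sum_(i < N) `[< A (iter i f x) >].

Definition frequency f x A N : R := (visits f x A N)%:R / N%:R.

Lemma visits_le f x A N : (visits f x A N <= N)%N.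
Proof.
rewrite /visits -[leqRHS]card_ord -sum1_card; apply: leq_sum => i _.
exact: leq_b1.
Qed.

Lemma le_visits f x A : {homo visits f x A : m n / (m <= n)%N}.
Proof.
apply: homo_leq => [//|n m p|N]; first exact: leq_trans.
by rewrite /visits big_ord_recr leq_addr.
Qed.

Lemma frequency_itv f x A N : 0 <= frequency f x A N <= 1.
Proof.
rewrite /frequency divr_ge0//=; have [->|N0] := posnP N; first by rewrite invr0 mulr0.
by rewrite ler_pdivrMr ?ltr0n// mul1r ler_nat visits_le.
Qed.

Lemma visitsU f x A B N : A `&` B = set0 ->
  visits f x (A `|` B) N = (visits f x A N + visits f x B N)%N.
Proof.
move=> AB; rewrite /visits -big_split/=; apply: eq_bigr => i _.
rewrite asbool_or; case: asboolP => // Ai; case: asboolP => // Bi.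
by have : (A `&` B) (iter i f x) by []; rewrite AB.
Qed.

Lemma frequencyU f x A B N : A `&` B = set0 ->
  frequency f x (A `|` B) N = frequency f x A N + frequency f x B N.
Proof. by move=> AB; rewrite /frequency visitsU// natrD mulrDl. Qed.

(** Both sides count the visits at times 0 to [N], with the first or the last time split off. *)
Lemma visits_preimage f x A N :
  (`[< A x >] + visits f x (f @^-1` A) N)%N =
  (visits f x A N + `[< A (iter N f x) >])%N.
Proof.
transitivity (visits f x A N.+1); first by rewrite /visits big_ord_recl.
by rewrite /visits big_ord_recr.
Qed.

Lemma frequency_preimage f x A N :
  `|frequency f x (f @^-1` A) N - frequency f x A N| <= N%:R^-1.
Proof.
rewrite /frequency -mulrBl normrM (@ger0_norm _ N%:R^-1) ?invr_ge0//.
rewrite ler_piMl ?invr_ge0//.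
have /(congr1 (fun n => n%:R : R)) := visits_preimage f x A N.
rewrite !natrD => E.
have -> : (visits f x (f @^-1` A) N)%:R - (visits f x A N)%:R =
  (`[< A (iter N f x) >] : nat)%:R - (`[< A x >] : nat)%:R :> R by lra.
by do 2 case: (`[< _ >]); rewrite /= ?subrr ?subr0 ?sub0r ?normrN ?normr0 ?normr1.
Qed.

End frequency.

Section Krylov_Bogoliubov.
Context {R : realType} {X : pmetricType R}.

Lemma borel_measure_unique (m1 m2 : {measure set (borel X) -> \bar R}) :
  (m1 setT < +oo)%E -> (forall U : set X, open U -> m1 U = m2 U) ->
  forall A : set (borel X), measurable A -> m1 A = m2 A.
Proof.
move=> m1T m12 A mA.
apply: (@measure_unique _ R (borel X) (@open X) (fun=> setT)) => //.
- exact: openI.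
- by move=> _; exact: openT.
- by rewrite bigcup_const//; exists 0%N.
Qed.

Lemma continuous_measurable_borel (f : X -> X) : continuous f ->
  measurable_fun [set: borel X] (f : borel X -> borel X).
Proof.
move=> cf; apply: (@measurability _ _ (borel X) (borel X) setT f (@open X)) => //.
move=> _ [U oU <-]; apply: sub_sigma_algebra; rewrite setTI.
by move/continuousP : cf; exact.
Qed.

(** The last clause needs a closed [K] inside [U]: the frequency limit of [U] itself may exceed
    [mu U], which is a supremum over closed subsets. *)
Lemma krylov_bogoliubov (f : X -> X) (x : X) :
  compact [set: X] -> continuous f ->
  exists mu : probability (borel X) R, [/\ invariant_measure f mu,
    (forall U : set X, open U -> (forall n, ~ U (iter n f x)) -> mu U = 0%E) &
    (forall (K U : set X) (c : R), closed K -> open U -> K `<=` U ->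
      (\forall N \near \oo, c <= frequency f x K N) -> (c%:E <= mu U)%E)].
Proof.
move=> cptX cf.
(* Along an ultrafilter finer than the filter at infinity the frequencies of all sets converge at
   once, so [nu] is finitely additive and invariant on all subsets. *)
have [G [GU Goo]] := ultraFilterLemma (@eventually_filter).
pose nu A : R := lim (frequency f x A @ G).
have nu_cvg A : cvg (frequency f x A @ G).
  by apply: ultra_bounded_cvg GU _ => N; exact: frequency_itv.
have nu_ge0 A : 0 <= nu A.
  apply: limr_ge; [exact: nu_cvg|]; apply: nearW => N.
  by have /andP[] := @frequency_itv R _ f x A N.
have nuT : nu setT = 1.
  apply/cvg_lim => //; apply: cvg_near_cst; apply: Goo.
  exists 1%N => // N /= N0; apply/eqP; rewrite /frequency /visits.
  under eq_bigr do rewrite asboolT//.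
  by rewrite sum_nat_const card_ord muln1 divff// pnatr_eq0 -lt0n.
have nuU A B : A `&` B = set0 -> nu (A `|` B) = nu A + nu B.
  move=> AB; apply/cvg_lim => //.
  rewrite (_ : frequency f x (A `|` B) = frequency f x A \+ frequency f x B).
    by apply: cvgD; exact: nu_cvg.
  by apply/funext => N; exact: frequencyU.
have nu_preimage A : nu (f @^-1` A) = nu A.
  apply/eqP; rewrite -subr_eq0 /nu -limB; [|exact: nu_cvg|exact: nu_cvg].
  apply/eqP/cvg_lim => //.
  pose h : nat -> R := frequency f x (f @^-1` A) - frequency f x A.
  suff h0 : h @ \oo --> 0.
    by apply: cvg_trans h0 => B; exact: Goo.
  apply/cvgr0Pnorm_le => e e0; near=> N.
  apply: le_trans (frequency_preimage _ _ _ _) _.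
  rewrite -[leRHS]invrK lef_pV2 ?posrE ?invr_gt0//.
    by near: N; exact: nbhs_infty_ger.
  by rewrite ltr0n; near: N; exact: nbhs_infty_gt.
have le_nu A B : A `<=` B -> nu A <= nu B.
  move=> AB; rewrite -(setDUK AB) nuU ?lerDl//.
  by rewrite setDE setICA setICr setI0.
have [mu muE] := regular_probability_of_content cptX nu_ge0 nuT nuU.
have sup_mu K U : closed K -> open U -> K `<=` U -> ((nu K)%:E <= mu U)%E.
  by move=> cK oU KU; rewrite muE//; apply: ereal_sup_ubound; exists K.
exists mu; split.
- have mf := continuous_measurable_borel cf.
  move=> A mA; change (pushforward mu (f : borel X -> borel X) A = mu A).
  apply: borel_measure_unique mA => [|U oU].
    apply: (@le_lt_trans _ _ (mu setT)); first exact: lexx.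
    by rewrite probability_setT ltry.
  have ofU : open (f @^-1` U) by move/continuousP : cf; exact.
  suff : mu (f @^-1` U) = mu U by [].
  (* Closed sets are transferred both ways: [K] inside the preimage of [U] is replaced by its
     compact image, and [K] inside [U] by its closed preimage. *)
  apply/eqP; rewrite eq_le; apply/andP; split; rewrite muE//.
    apply: ge_ereal_sup => _ [K [cK KU] <-].
    apply: (@le_trans _ _ (nu (f @` K))%:E).
      by rewrite lee_fin -[leRHS]nu_preimage; apply: le_nu; exact: preimage_image.
    apply: sup_mu => //; last by move=> _ [y /KU ? <-].
    apply: compact_closed; first exact: (@metric_hausdorff R X).
    apply: continuous_compact; first exact: continuous_subspaceT.
    exact: subclosed_compact cK cptX _.
  apply: ge_ereal_sup => _ [K [cK KU] <-]; rewrite -nu_preimage.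
  apply: sup_mu => //; first by move/continuous_closedP : cf; exact.
  exact: preimage_subset.
- move=> U oU xU; apply/eqP; rewrite eq_le measure_ge0 andbT muE//.
  apply: ge_ereal_sup => _ [K [cK KU] <-]; rewrite lee_fin.
  apply: limr_le; [exact: nu_cvg|]; apply: nearW => N.
  rewrite /frequency /visits big1 ?mul0r// => i _.
  by rewrite asboolF// => /KU; exact: xU.
- move=> K U c cK oU KU cN; apply: le_trans (sup_mu K U cK oU KU).
  by rewrite lee_fin; apply: limr_ge; [exact: nu_cvg|exact: Goo].
Unshelve. all: by end_near. Qed.

End Krylov_Bogoliubov.

(** * Unique ergodicity implies minimality *)

Section tracing.
Context {R : realType} {X : pmetricType R}.
Implicit Types f : X -> X.

(** Gaps are replaced by starting times: consecutive ones differ by [n + t - 1], and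
    [1 <= t <= 1 + delta * n] gives both bounds. *)
Lemma strict_tracing f (delta eps : R) :
  strict_approximate_product_property f -> 0 < delta -> 0 < eps ->
  \forall n \near \oo, forall C : nat -> X, exists (s : nat -> nat) (z : X),
    [/\ s 0%N = 0%N, forall k, (s k + n <= s k.+1)%N,
      forall k, (s k.+1)%:R <= (s k)%:R + (1 + delta) * n%:R :> R &
      forall k j, (j < n)%N ->
        mdist (iter (s k + j) f z) (iter j f (C k)) <= eps].
Proof.
move=> fP d0 e0; have [M _ MP] := fP _ _ d0 e0.
near=> n => C.
have [|t [z [tP trz]]] := MP n _ C.
  by near: n; exact: nbhs_infty_gtr.
exists (trace_start (fun=> n) t), z; split.
- by rewrite /trace_start big_ord0.
- move=> k; rewrite /trace_start big_ord_recr/=.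
  by have [tk _] := tP k; lia.
- move=> k; rewrite /trace_start big_ord_recr/= natrD lerD2l.
  have [tk tk1] := tP k; rewrite -addnBA// natrD natrB//.
  by lra.
- move=> k j jn; rewrite leNgt; apply/negP => ej.
  (* With tolerance 0 the set of bad times is empty. *)
  have := trz k; rewrite mul0r lern0 => /eqP/card0_eq/(_ (Ordinal jn)).
  by rewrite !inE/= ej.
Unshelve. all: by end_near. Qed.

Lemma open_mball (y : X) (e : R) : open [set w | mdist y w < e].
Proof.
rewrite openE => w /= yw; apply/nbhs_ballP.
exists (e - mdist y w); first by rewrite /= subr_gt0.
move=> v; rewrite ballEmdist/= => wv.
by rewrite (le_lt_trans (metric_triangle _ w _))// -ltrBrDl.
Qed.

Lemma closed_mball (y : X) (e : R) : closed [set w | mdist y w <= e].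
Proof.
rewrite -openC (_ : ~` _ = [set w | e < mdist y w]); last first.
  by apply/seteqP; split => w /=; rewrite ltNge => /negP.
rewrite openE => w /= yw; apply/nbhs_ballP.
exists (mdist y w - e); first by rewrite /= subr_gt0.
move=> v; rewrite ballEmdist/= => wv.
have := metric_triangle y v w; rewrite (metric_sym v w); lra.
Qed.

End tracing.

Section full_support.
Context {R : realType} {X : pmetricType R}.
Implicit Types f : X -> X.

Lemma visits_lower_bound f (z : X) (K : set X) (s : nat -> nat) :
  (forall k, (s k < s k.+1)%N) -> (forall k, K (iter (s k) f z)) ->
  forall k, (k <= visits f z K (s k))%N.
Proof.
move=> s_lt sK; elim=> // k IH.
apply: leq_trans (le_visits _ _ _ (s_lt k)).
by rewrite /visits big_ord_recr/= asboolT ?addn1.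
Qed.

Lemma uniquely_ergodic_minimal f : compact [set: X] -> continuous f ->
  strict_approximate_product_property f -> uniquely_ergodic f ->
  minimal_system f.
Proof.
move=> cptX cf fP [_ uniq] x; apply: contrapT => /denseNE[V [[y [oV Vy]] V0]].
have /nbhs_ballP[e /= e0 yeV] : nbhs y V by exact: open_nbhs_nbhs.
(* Gap tolerance 1 puts block starts at most [2 * n] apart; radius [e / 2] leaves a closed ball [K]
   inside [V]. *)
have [n [n0]] : exists n, (0 < n)%N /\ forall C : nat -> X,
    exists (s : nat -> nat) (z : X), [/\ s 0%N = 0%N,
      forall k, (s k + n <= s k.+1)%N,
      forall k, (s k.+1)%:R <= (s k)%:R + (1 + 1) * n%:R :> R &
      forall k j, (j < n)%N ->
        mdist (iter (s k + j) f z) (iter j f (C k)) <= e / 2].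
  near \oo => n; exists n; split; first by near: n; exact: nbhs_infty_gt.
  by near: n; apply: strict_tracing => //; rewrite divr_gt0.
move=> /(_ (fun=> y))[s [z [s0 s_ge s_le trz]]].
pose K := [set w | mdist y w <= e / 2].
have KV : K `<=` V.
  by move=> w yw; apply: yeV; rewrite ballEmdist/=; move: yw; rewrite /K/=; lra.
have sK k : K (iter (s k) f z).
  by rewrite /K/= metric_sym; have := trz k 0%N n0; rewrite addn0.
have s_lt k : (s k < s k.+1)%N by have := s_ge k; lia.
have s_le2 k : (s k <= k * (2 * n))%N.
  elim: k => [|k IH]; first by rewrite s0.
  have : (s k.+1 <= s k + 2 * n)%N.
    by rewrite -(ler_nat R) natrD natrM; have := s_le k; lra.
  lia.
have vis k N : (s k <= N)%N -> (k <= visits f z K N)%N.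
  move=> skN; apply: leq_trans (visits_lower_bound s_lt sK k) _.
  exact: le_visits.
have [mux [invx mux0 _]] := krylov_bogoliubov x cptX cf.
have [muz [invz _ muzK]] := krylov_bogoliubov z cptX cf.
(* For [k = N %/ (2 * n)], at least [k] visits occur before time [N], and
   [N < (k + 1) * 2 * n <= 4 * n * k] once [k >= 1]; hence the constant [1 / (4 * n)]. *)
have := muzK K V (4 * n%:R)^-1 (@closed_mball R X y (e / 2)) oV KV.
rewrite (uniq _ _ invz invx); last exact: sub_sigma_algebra.
rewrite mux0 => [|//|m Vm]; last first.
  by suff : set0 (iter m f x) by []; rewrite -V0; split=> //; exists m.
rewrite lee_fin leNgt invr_gt0 mulr_gt0 ?ltr0n// => visF.
have // : ~~ true; apply: visF; exists (4 * n)%N => // N /= nN.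
rewrite /frequency ler_pdivlMr; last by rewrite ltr0n; lia.
rewrite mulrC ler_pdivrMr ?mulr_gt0 ?ltr0n//.
have kN : (s (N %/ (2 * n)) <= N)%N.
  by rewrite (leq_trans (s_le2 _))// leq_trunc_div.
rewrite (@le_trans _ _ ((N %/ (2 * n))%:R * (4 * n%:R)))//; last first.
  by rewrite ler_wpM2r ?mulr_ge0// ler_nat vis.
rewrite -!natrM ler_nat.
have := ltn_ceil N (_ : 0 < 2 * n)%N; rewrite muln_gt0 n0 => /(_ isT).
have : (1 <= N %/ (2 * n))%N by rewrite leq_divRL; lia.
nia.
Unshelve. all: by end_near. Qed.

End full_support.

(** * Minimality implies zero entropy *)

Section itinerary.
Context {L Q : eqType} (l : nat -> L) (next : L -> option L) (q : L -> Q).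
Hypothesis next_l : forall i a, next (l i) = Some a -> l i.+1 = a.
Hypothesis q_inj : forall i i', next (l i) = None -> next (l i') = None ->
  q (l i.+1) = q (l i'.+1) -> l i.+1 = l i'.+1.

(* A path [l] is deterministic where [next] is defined, so it is determined by
   its origin and by the values of [q] after the remaining (branching) times. *)
Definition branch i := next (l i) == None.

Definition choices i N := [seq q (l t.+1) | t <- iota i N & branch t].

(** Two paths with equal current labels branch together, so their lists of choices stay aligned
    during the induction. *)
Lemma choices_inj N i i' : l i = l i' -> choices i N = choices i' N ->
  forall j, (j <= N)%N -> l (i + j) = l (i' + j).
Proof.
elim: N i i' => [|N IH] i i' lii'; first by move=> _ [|//]; rewrite !addn0.
rewrite /choices /= /branch -lii'; case nxi : (next (l i)) => [a|] /=.
  move=> cE [|j] jN; first by rewrite !addn0.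
  rewrite !addnS -!addSn; apply: IH => //.
  by rewrite (next_l nxi); apply/esym/next_l; rewrite -lii'.
move=> [qE cE] [|j] jN; first by rewrite !addn0.
rewrite !addnS -!addSn; apply: IH => //.
by apply: q_inj => //; rewrite -lii'.
Qed.

End itinerary.

(** * Coding windows of the tracing orbit by what happens in the gaps *)

Section gap_coding.
Context {R : realType} {X : pmetricType R} {Q : finType}.
Variables (f : X -> X) (z y : X) (c : X -> Q) (s : nat -> nat) (n g : nat).
Variable e : R.
Hypothesis n_gt0 : (0 < n)%N.
Hypothesis s0 : s 0%N = 0%N.
Hypothesis s_ge : forall k, (s k + n <= s k.+1)%N.
Hypothesis s_le : forall k, (s k.+1 < s k + n + g)%N.
Hypothesis trz : forall k j, (j < n)%N ->
  mdist (iter (s k + j) f z) (iter j f y) <= e.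
Hypothesis cP : forall x x', c x = c x' -> mdist x x' <= e *+ 2.

(* At time [i] the orbit of [z] is either at position [j] of a block shadowing
   the orbit of [y], or in a gap, where only the cell of [c] is recorded. *)
Definition label (i : nat) : ('I_n + Q)%type :=
  if pselect (exists j : 'I_n, exists k, i = (s k + j)%N) is left ij
  then inl (sval (cid ij)) else inr (c (iter i f z)).

(** At the last position of a block [insub] fails, so that position branches, as does every gap
    label. *)
Definition next_label (a : 'I_n + Q) : option ('I_n + Q) :=
  if a is inl j then omap inl (insub j.+1) else None.

(** A branching time is followed by a gap cell or by position 0 of a block; [None] stands for the
    latter. *)
Definition gap_label (a : 'I_n + Q) : option Q := if a is inr p then Some p else None.

Let s_mono k k' : (k <= k')%N -> (s k + (k' - k) * n <= s k')%N.
Proof.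
move=> kk'; rewrite -[in leqRHS](subnKC kk').
elim: (k' - k)%N => [|d IH]; first by rewrite !addn0.
by rewrite addnS; have := s_ge (k + d); lia.
Qed.

Let block_inj k k' (j j' : 'I_n) : (s k + j = s k' + j')%N -> j = j'.
Proof.
wlog: k k' j j' / (k <= k')%N => [W E|kk' E].
  by have [kk'|/ltnW kk'] := leqP k k'; [exact: (W k k')|exact/esym/(W k' k)].
apply/val_inj => /=; move: kk'; rewrite leq_eqVlt => /orP[/eqP kk'|kk'].
  by move: E; rewrite kk'; lia.
have sk := s_mono kk'.
have := s_ge k; have := ltn_ord j; nia.
Qed.

Let label_block k (j : 'I_n) : label (s k + j) = inl j.
Proof.
rewrite /label; case: pselect => [ij|]; last by case; exists j, k.
by case: cid => j' /= [k' E]; rewrite (block_inj E).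
Qed.

Let labelP i : (exists k, exists j : 'I_n, i = (s k + j)%N /\ label i = inl j) \/
  label i = inr (c (iter i f z)).
Proof.
rewrite /label; case: pselect => [ij|]; last by right.
by left; case: cid => j /= [k E]; exists k, j.
Qed.

Let next_label_l i a : next_label (label i) = Some a -> label i.+1 = a.
Proof.
have [[k [j [-> ->]]]/=|->//] := labelP i.
by case: insubP => //= j' _ j'E [<-]; rewrite -addnS -j'E label_block.
Qed.

(** A position [j > 0] is preceded by position [j - 1], where the next label is forced. *)
Let branch_inl i j : next_label (label i) = None -> label i.+1 = inl j ->
  j = 0%N :> nat.
Proof.
have [[k [j' [iE ->]]] + [jj']|-> //] := labelP i.+1; rewrite -{}jj'.
case: j' iE => [[//|j'] j'n] iE /=.
have -> : i = (s k + Ordinal (ltnW j'n))%N by move: iE => /=; lia.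
by rewrite label_block/= insubT.
Qed.

Let gap_label_inj i i' :
  next_label (label i) = None -> next_label (label i') = None ->
  gap_label (label i.+1) = gap_label (label i'.+1) -> label i.+1 = label i'.+1.
Proof.
move=> /branch_inl bi /branch_inl bi'.
case E: (label i.+1) => [j|p]; case E': (label i'.+1) => [j'|p'] //=.
  by move=> _; congr inl; apply/val_inj; rewrite /= (bi _ E) (bi' _ E').
by move=> [->].
Qed.

Let b m := count (branch label next_label) (iota 0 m).

Let bD m d : b (m + d) = (b m + count (branch label next_label) (iota m d))%N.
Proof. by rewrite /b iotaD count_cat add0n. Qed.

Let b_le m d : (b (m + d) <= b m + d)%N.
Proof. by rewrite bD leq_add2l (leq_trans (count_size _ _))// size_iota. Qed.

Let b_mono m m' : (m <= m')%N -> (b m <= b m')%N.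
Proof. by move=> /subnKC <-; rewrite bD leq_addr. Qed.

(** Between two block starts only the last position of the block and the gap can branch, at most [g]
    times in all. *)
Let b_block k : (b (s k.+1) <= b (s k) + g)%N.
Proof.
have bj j : (j < n)%N -> b (s k + j) = b (s k).
  elim: j => [|j IH] jn; first by rewrite addn0.
  rewrite addnS -addn1 bD IH ?(ltnW jn)//= /branch.
  by rewrite (label_block k (Ordinal (ltnW jn)))/= insubT/= !addn0.
have skE : s k.+1 = (s k + n.-1 + (s k.+1 - (s k + n.-1)))%N.
  by have := s_ge k; lia.
have := b_le (s k + n.-1) (s k.+1 - (s k + n.-1)).
rewrite -skE bj; last by lia.
by have := s_le k; have := s_ge k; lia.
Qed.

(** The stretch between block starts that contains [i] may be cut short, but the next [N %/ n + 1]
    stretches have length at least [n] and together exceed [N]. *)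
Let b_window i N : (b (i + N) <= b i + (N %/ n + 2) * g)%N.
Proof.
have bk k d : (b (s (k + d)) <= b (s k) + d * g)%N.
  elim: d => [|d IH]; first by rewrite addn0; lia.
  by rewrite addnS; have := b_block (k + d); lia.
have [k /andP[ski iSk]] : exists k, (s k <= i < s k.+1)%N.
  elim: i => [|i [k ik]]; first by exists 0%N; have := s_ge 0; lia.
  have [iSk|Ski] := ltnP i.+1 (s k.+1); first by exists k; lia.
  by exists k.+1; have := s_ge k.+1; lia.
apply: leq_trans (b_mono (_ : _ <= s (k + (N %/ n + 2)))%N) _; last first.
  by rewrite (leq_trans (bk _ _))// leq_add2r b_mono.
have := ltn_ceil N n_gt0; move: (N %/ n)%N => d Nd.
have kd : (k.+1 <= k + (d + 2))%N by lia.
have dE : (k + (d + 2) - k.+1 = d.+1)%N by lia.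
by have := s_mono kd; rewrite dE; lia.
Qed.

Let mdist_label i i' : label i = label i' ->
  mdist (iter i f z) (iter i' f z) <= e *+ 2.
Proof.
have [[k [j [-> ->]]]|->] := labelP i.
  have [[k' [j' [-> ->]]] [<-]|-> //] := labelP i'.
  rewrite (le_trans (metric_triangle _ (iter j f y) _))// mulr2n lerD ?trz//.
  by rewrite metric_sym trz.
have [[k' [j' [-> ->]]] //|->] := labelP i'.
by case=> /cP.
Qed.

(** Equal codes keep two windows within [2 * e], and shadowing costs [e] on each side; points
    separated at scale [eps >= 4 * e] thus have different codes. *)
Lemma separated_code N (eps : R) (E : {fset X}) : 4%:R * e <= eps ->
  (forall x, exists i, forall j, (j < N)%N ->
    mdist (iter (i + j) f z) (iter j f x) <= e) ->
  Defs.separated f N eps E ->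
  (#|` E|%fset <= (n + #|Q|) * #|Q|.+2 ^ ((N %/ n + 2) * g))%N.
Proof.
move=> e_eps /choice[i iP] sepE; set B := ((N %/ n + 2) * g)%N.
pose ch x := choices label next_label gap_label (i x) N.
have size_ch x : (size (ch x) <= B)%N.
  rewrite size_map size_filter; have := b_window (i x) N.
  by rewrite bD leq_add2l.
(* [onth] pads the choices with [None] to the common length [B]; this is the outer [option], whence
   [#|Q| + 2] symbols. *)
pose code x : ('I_n + Q) * (B.-tuple (option (option Q))) :=
  (label (i x), [tuple onth (ch x) k | k < B]).
have code_inj : {in E &, injective code}.
  move=> x x' xE x'E codeE; apply: contrapT => /eqP xx'.
  have lE : label (i x) = label (i x') := congr1 fst codeE.
  have chE : ch x = ch x'.
    apply/eq_from_onth => k.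
    have [kB|Bk] := ltnP k B.
      by have := congr1 (fun u => tnth u.2 (Ordinal kB)) codeE; rewrite !tnth_mktuple.
    by rewrite !onth_default// (leq_trans (size_ch _)).
  have [j jN] := sepE _ _ xE x'E xx'.
  have lab := choices_inj next_label_l gap_label_inj lE chE (ltnW jN).
  apply/negP; rewrite -leNgt.
  have := mdist_label lab; have := iP x j jN; have := iP x' j jN.
  have := metric_triangle (iter j f x) (iter (i x + j) f z) (iter j f x').
  have := metric_triangle (iter (i x + j) f z) (iter (i x' + j) f z) (iter j f x').
  rewrite (metric_sym (iter j f x) (iter (i x + j) f z)) mulr2n; lra.
have cU : uniq [seq code x | x <- enum_fset E].
  by rewrite (map_inj_in_uniq code_inj) fset_uniq.
have := card_uniqP cU; rewrite size_map => <-.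
rewrite (leq_trans (max_card _))//.
by rewrite card_prod card_sum card_ord card_tuple !card_option.
Qed.

End gap_coding.

(** * Bounds on the entropy at a fixed scale *)

Section entropy.
Context {R : realType} {X : pmetricType R}.
Implicit Types f : X -> X.

Lemma separated_card_ge1 f n (eps : R) : (1 <= separated_card f n eps)%E.
Proof.
apply: ereal_sup_ubound; exists [fset point]%fset; last by rewrite cardfs1.
by move=> x y; rewrite !inE => /eqP -> /eqP ->; rewrite eqxx.
Qed.

Lemma separated_cardS f n (eps eps' : R) : eps <= eps' ->
  (separated_card f n eps' <= separated_card f n eps)%E.
Proof.
move=> ee'; apply: ereal_sup_le => _ [E sE <-]; exists E => // x y xE yE xy.
by have [j jn ej] := sE _ _ xE yE xy; exists j => //; exact: le_lt_trans ej.
Qed.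

Lemma lne_separated_card_ge0 f n (eps : R) :
  (0 <= (n%:R^-1)%:E * lne (separated_card f n eps))%E.
Proof.
by rewrite mule_ge0 ?lee_fin ?invr_ge0// lne_ge0 separated_card_ge1.
Qed.

Lemma entropy_at_scale_ge0 f (eps : R) : (0 <= entropy_at_scale f eps)%E.
Proof.
apply: limf_esup_ge0; last by move=> n; exact: lne_separated_card_ge0.
by case=> N _ /(_ N); apply => /=.
Qed.

Lemma entropy_at_scale_le f (eps l : R) :
  (\forall n \near \oo, separated_card f n eps <= (expR (l * n%:R))%:E)%E ->
  (entropy_at_scale f eps <= l%:E)%E.
Proof.
move=> [N _ sN]; rewrite /entropy_at_scale /limn_esup limf_esupE.
apply: ereal_inf_le; exists (ereal_sup [set
  ((n%:R^-1)%:E * lne (separated_card f n eps))%E | n in [set n | (N < n)%N]]).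
  by exists [set n | (N < n)%N] => //; exists N.+1.
apply: ge_ereal_sup => _ [n /= Nn <-].
have n0 : 0 < n%:R :> R by rewrite ltr0n; lia.
rewrite muleC -lee_pdivlMr ?invr_gt0// invrK -EFinM.
rewrite -[leRHS]expeRK lee_lne.
- by apply: sN => /=; exact: ltnW.
- by rewrite in_itv/= leey (le_trans _ (separated_card_ge1 _ _ _)).
- by rewrite in_itv/= leey lee_fin expR_ge0.
Qed.

Lemma entropy_at_scale_ge f (eps l : R) :
  (forall N, exists2 n, (N <= n)%N &
    (expR (l * n%:R))%:E <= separated_card f n eps)%E ->
  (l%:E <= entropy_at_scale f eps)%E.
Proof.
move=> sN; rewrite /entropy_at_scale /limn_esup limf_esupE.
apply: le_ereal_inf_tmp => _ [V [N _ NV] <-].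
have [n Nn ln] := sN N.+1.
apply: le_ereal_sup_tmp; exists ((n%:R^-1)%:E * lne (separated_card f n eps))%E.
  by exists n => //; apply: NV => /=; lia.
have n0 : 0 < n%:R :> R by rewrite ltr0n; lia.
rewrite muleC lee_pdivlMr// -EFinM.
rewrite -[leLHS]expeRK lee_lne//=.
- by rewrite in_itv/= leey lee_fin expR_ge0.
- by rewrite in_itv/= leey (le_trans _ (separated_card_ge1 _ _ _)).
Qed.

(** The entropy at scale [eps] is nonnegative and nonincreasing in [eps], so its limit at 0 from the
    right is the supremum over all scales. *)
Lemma topological_entropy_eq0 f : topological_entropy f = 0%E <->
  forall eps, 0 < eps -> entropy_at_scale f eps = 0%E.
Proof.
have entS (e e' : R) : e <= e' ->
    (entropy_at_scale f e' <= entropy_at_scale f e)%E.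
  move=> ee'; rewrite /entropy_at_scale /limn_esup !limf_esupE.
  apply: le_ereal_inf_tmp => _ [V FV <-]; apply: ereal_inf_le.
  exists (ereal_sup [set ((n%:R^-1)%:E * lne (separated_card f n e'))%E | n in V]).
    by exists V.
  apply: ge_ereal_sup => _ [n Vn <-].
  apply: le_ereal_sup_tmp; exists ((n%:R^-1)%:E * lne (separated_card f n e))%E.
    by exists n.
  rewrite lee_wpmul2l ?lee_fin ?invr_ge0// lee_lne ?separated_cardS//.
  - by rewrite in_itv/= leey (le_trans _ (separated_card_ge1 _ _ _)).
  - by rewrite in_itv/= leey (le_trans _ (separated_card_ge1 _ _ _)).
have -> : topological_entropy f =
    ereal_sup (entropy_at_scale f @` [set` `]0, +oo[%R]).
  apply/cvg_lim => //.
  apply: nonincreasing_at_right_cvge  => // e e' _ _; exact: entS.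
split=> [sup0 e e0|ent0].
  apply/eqP; rewrite eq_le entropy_at_scale_ge0 andbT -sup0.
  by apply: ereal_sup_ubound; exists e => //=; rewrite in_itv/= e0.
apply/eqP; rewrite eq_le; apply/andP; split.
  apply: ge_ereal_sup => _ [e e0 <-].
  by move: e0; rewrite /= in_itv/= andbT => /ent0 ->.
apply: le_ereal_sup_tmp; exists (entropy_at_scale f 1); last by rewrite ent0.
by exists 1 => //=; rewrite in_itv/= ltr01.
Qed.

End entropy.

Section minimal_zero_entropy.
Context {R : realType} {X : pmetricType R}.
Implicit Types f : X -> X.

Lemma finite_cover (e : R) : compact [set: X] -> 0 < e ->
  exists (Q : finType) (c : X -> Q),
    forall x x', c x = c x' -> mdist x x' <= e *+ 2.
Proof.
rewrite compact_cover => cptX e0.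
have [||D _ XD] := cptX X setT (fun x => [set w | mdist x w < e]).
- by move=> x _; exact: open_mball.
- by move=> x _; exists x => //=; rewrite mdistxx.
have /choice[c cP] : forall x, exists d : D, mdist (val d) x < e.
  by move=> x; have [d dD dx] := XD x I; exists [` dD]%fset.
exists D, c => x x' cE.
rewrite (le_trans (metric_triangle _ (val (c x)) _))// mulr2n lerD//.
  by rewrite metric_sym ltW.
by rewrite cE ltW.
Qed.

Lemma continuous_iter f j : continuous f -> continuous (iter j f).
Proof.
move=> cf; elim: j => [|j IH] x; first exact: cvg_id.
by apply: continuous_comp; [exact: IH|exact: cf].
Qed.

(** By continuity a whole neighbourhood of [x] shadows its first [N] steps, and the dense orbit of
    [z] enters it. *)
Lemma minimal_shadow f (z x : X) (e : R) N : continuous f ->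
  minimal_system f -> 0 < e ->
  exists i, forall j, (j < N)%N ->
    mdist (iter (i + j) f z) (iter j f x) <= e.
Proof.
move=> cf minf e0.
have nbx : \forall w \near x, forall j, (j < N)%N ->
    mdist (iter j f w) (iter j f x) <= e.
  elim: N => [|N IH]; first exact: nearW.
  have /cvg_ballP/(_ e e0) wN := @continuous_iter f N cf x.
  apply: filterS2 IH wN => w IH wN j; rewrite ltnS leq_eqVlt => /orP[/eqP ->|].
    by move: wN; rewrite ballEmdist/= metric_sym; exact: ltW.
  exact: IH.
have [w [/interior_subset wP [i _ iw]]] :=
  minf z _ (ex_intro _ x nbx) (@open_interior _ _).
by exists i => j jN; rewrite addnC iterD iw; exact: wP.
Qed.

Lemma minimal_zero_entropy f : compact [set: X] -> continuous f ->
  strict_approximate_product_property f -> minimal_system f ->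
  topological_entropy f = 0%E.
Proof.
move=> cptX cf fP minf; apply/topological_entropy_eq0 => eps eps0.
apply/eqP; rewrite eq_le entropy_at_scale_ge0 andbT.
apply/lee_addgt0Pr => eta eta0; rewrite add0e.
have e0 : 0 < eps / 4 by rewrite divr_gt0.
have [Q [c cP]] := finite_cover cptX e0.
pose b : R := #|Q|.+2%:R; have lnb0 : 0 < ln b by rewrite ln_gt0// ltr1n.
(* Together with [4 * ln b <= eta * n] this bounds the cost of one gap: [g * ln b <= (1 + delta * n)
   * ln b <= eta * n / 2]. *)
pose delta := eta / (4 * ln b).
have delta0 : 0 < delta by rewrite divr_gt0 ?mulr_gt0.
have deltaE : delta * ln b = eta / 4.
  by rewrite /delta; field; rewrite gt_eqF.
have [n [n0 nb tr]] : exists n, [/\ (0 < n)%N, 4 * ln b <= eta * n%:R &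
    forall C : nat -> X, exists (s : nat -> nat) (z : X),
    [/\ s 0%N = 0%N, forall k, (s k + n <= s k.+1)%N,
      forall k, (s k.+1)%:R <= (s k)%:R + (1 + delta) * n%:R :> R &
      forall k j, (j < n)%N ->
        mdist (iter (s k + j) f z) (iter j f (C k)) <= eps / 4]].
  near \oo => n; exists n; split; first by near: n; exact: nbhs_infty_gt.
    by rewrite [eta * _]mulrC -ler_pdivrMr//; near: n; exact: nbhs_infty_ger.
  by near: n; exact: strict_tracing.
have [s [z [s0 s_ge s_le trz]]] := tr (fun=> point).
have dn0 : 0 <= delta * n%:R by rewrite mulr_ge0// ltW.
pose g := (Num.truncn (delta * n%:R)).+1.
have s_lt k : (s k.+1 < s k + n + g)%N.
  rewrite addnS ltnS -leq_subLR truncn_ge_nat//.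
  rewrite natrB ?s_ge// natrD; have := s_le k; lra.
have g_le : g%:R <= 1 + delta * n%:R :> R.
  by rewrite /g -natr1 addrC lerD2l truncn_le.
apply: entropy_at_scale_le; near=> N.
apply: ge_ereal_sup => _ [E sE <-]; rewrite lee_fin.
have := separated_code n0 s0 s_ge s_lt trz cP _
  (fun x => minimal_shadow z x N cf minf e0) sE.
rewrite mulrC divfK// lexx => /(_ isT); rewrite -(ler_nat R) => /le_trans; apply.
rewrite natrM natrX -/b -ler_ln ?posrE ?expR_gt0//; last first.
  by rewrite mulr_gt0 ?exprn_gt0 ?ltr0n//; lia.
rewrite expRK lnM ?posrE ?exprn_gt0 ?ltr0n//; last by lia.
have b0 : 0 < b by rewrite ltr0n.
rewrite lnXn// -[ln b *+ _]mulr_natr natrM natrD.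
set a := ln _; set d := (N %/ n)%N; set beta := ln b in lnb0 nb deltaE *.
have dN : d%:R * n%:R <= N%:R :> R by rewrite -natrM ler_nat leq_trunc_div.
have gbeta : g%:R * beta <= eta * n%:R / 2.
  apply: (@le_trans _ _ ((1 + delta * n%:R) * beta)).
    by rewrite ler_wpM2r// ltW.
  rewrite mulrDl mul1r mulrAC deltaE; lra.
(* The choices cost at most [eta * N / 2 + eta * n]; for large [N] the other half of [eta * N]
   absorbs [eta * n] and the logarithm [a] of [n + #|Q|]. *)
have Nlarge : (a + eta * n%:R) / (eta / 2) <= N%:R.
  by near: N; exact: nbhs_infty_ger.
rewrite ler_pdivrMr ?divr_gt0// in Nlarge.
have : (d%:R + 2) * (g%:R * beta) <= (d%:R + 2) * (eta * n%:R / 2).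
  by rewrite ler_wpM2l ?addr_ge0.
have : eta * (d%:R * n%:R) <= eta * N%:R by apply: ler_wpM2l => //; exact: ltW.
lra.
Unshelve. all: by end_near. Qed.

End minimal_zero_entropy.

(** * Zero entropy implies unique ergodicity *)

Section counting.

(** Shifting by [d] sends the times counted by [p] to times counted by [q], except for the last
    [d]. *)
Lemma count_shiftr (p q : pred nat) n d :
  (forall j, (j + d < n)%N -> p j -> q (j + d)%N) ->
  (\sum_(j < n) p j <= \sum_(j < n) q j + d)%N.
Proof.
move=> pq; have [nd|dn] := leqP n d.
  apply: leq_trans (leq_addl _ _); apply: leq_trans nd.
  rewrite -[leqRHS]card_ord -sum1_card; apply: leq_sum => i _; exact: leq_b1.
rewrite -(subnK (ltnW dn)); set m := (n - d)%N.
have mdn : (m + d = n)%N by rewrite /m; lia.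
have pm : (\sum_(j < m + d) p j <= \sum_(j < m) p j + d)%N.
  elim: (d) => [|k IH]; first by rewrite !addn0.
  by rewrite !addnS big_ord_recr/= -addn1 leq_add ?leq_b1.
apply: leq_trans pm _; rewrite leq_add2r.
have : forall k, (k <= m)%N -> (\sum_(j < k) p j <= \sum_(j < k + d) q j)%N.
  elim=> [|k IH] km; first by rewrite big_ord0.
  rewrite addSn !big_ord_recr/=; apply: leq_add; first by apply: IH; lia.
  by have := pq k; case: (p k) => // /(_ _ isT) -> //; lia.
exact.
Qed.

(** Complementing both predicates turns this into a right shift. *)
Lemma count_shiftl (p q : pred nat) n d :
  (forall j, (j + d < n)%N -> p (j + d)%N -> q j) ->
  (\sum_(j < n) p j <= \sum_(j < n) q j + d)%N.
Proof.
move=> pq; have := @count_shiftr (predC q) (predC p) n d.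
have C (r : pred nat) : (\sum_(j < n) predC r j = n - \sum_(j < n) r j)%N.
  have : (\sum_(j < n) predC r j + \sum_(j < n) r j = n)%N.
    rewrite -big_split/= -[RHS]card_ord -sum1_card; apply: eq_bigr => i _ /=.
    by case: (r i).
  lia.
have le_n (r : pred nat) : (\sum_(j < n) r j <= n)%N.
  rewrite -[leqRHS]card_ord -sum1_card; apply: leq_sum => i _; exact: leq_b1.
have := le_n p; have := le_n q; rewrite !C => qn pn /(_ _).
move=> H; have {}H := H _; move: H => /(_ (fun j jd => contra (pq j jd))); lia.
Qed.

Lemma pigeonhole (W V : finType) (h : W -> V) c :
  (#|V| * c < #|W|)%N -> exists v, (c < #|[pred w | h w == v]|)%N.
Proof.
move=> VW; apply/existsP; apply: contraLR VW => /existsPn hc.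
rewrite -leqNgt -sum1_card (partition_big h xpredT)//= -sum_nat_const.
by apply: leq_sum => v _; rewrite sum1_card leqNgt; exact: hc.
Qed.

End counting.

Section separation.
Context {R : realType} {X : pmetricType R}.
Variables (f : X -> X) (F U : set X) (x y : X) (eps : R) (n : nat).
Hypothesis FU : forall v w, F v -> mdist v w <= eps *+ 3 -> U w.

(** If [z] and [z'] stayed [eps]-close, three errors of [eps] would turn each visit of [x] to [F]
    into a visit of [y] to [U] at a time shifted by at most [D], apart from at most [D] boundary
    times; the counts differ by more. *)
Lemma shifted_traces_separated (z z' : X) (S S' D T : nat) :
  (S + n <= T)%N -> (S' + n <= T)%N -> (S <= S' + D)%N -> (S' <= S + D)%N ->
  (forall j, (j < n)%N -> mdist (iter (S + j) f z) (iter j f x) <= eps) ->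
  (forall j, (j < n)%N -> mdist (iter (S' + j) f z') (iter j f y) <= eps) ->
  (visits f y U n + D < visits f x F n)%N ->
  exists2 i, (i < T)%N & eps < mdist (iter i f z) (iter i f z').
Proof.
move=> ST ST' SD SD' zx zy vis; apply: contrapT => nsep.
have close i : (i < T)%N -> mdist (iter i f z) (iter i f z') <= eps.
  by move=> iT; rewrite leNgt; apply/negP => ?; apply: nsep; exists i.
have key j j' : (j < n)%N -> (j' < n)%N -> (S + j = S' + j')%N ->
    F (iter j f x) -> U (iter j' f y).
  move=> jn j'n E Fj; apply: FU Fj _.
  have := zx j jn; have := zy j' j'n; have := close (S + j)%N ltac:(lia).
  rewrite -E => d1 d2 d3; rewrite metric_sym in d3.
  have t1 := metric_triangle (iter j f x) (iter (S + j) f z) (iter j' f y).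
  have t2 := metric_triangle (iter (S + j) f z) (iter (S + j) f z') (iter j' f y).
  by rewrite mulrSr mulr2n; lra.
move: vis; rewrite ltnNge => /negP; apply.
have [SS'|/ltnW SS'] := leqP S S'.
  apply: (@leq_trans (visits f y U n + (S' - S))%N); last by lia.
  apply: (count_shiftl (p := fun j => `[< F (iter j f x) >])
    (q := fun j => `[< U (iter j f y) >])) => j jn /asboolP Fj; apply/asboolP.
  by apply: key Fj => //; lia.
apply: (@leq_trans (visits f y U n + (S - S'))%N); last by lia.
apply: (count_shiftr (p := fun j => `[< F (iter j f x) >])
  (q := fun j => `[< U (iter j f y) >])) => j jn /asboolP Fj; apply/asboolP.
by apply: key Fj => //; lia.
Qed.

End separation.

(** * Exponentially many separated points from words in two letters *)

Section horseshoe.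
Context {R : realType} {X : pmetricType R}.
Variables (f : X -> X) (F U : set X) (x y : X) (eps : R) (n h : nat).
Hypothesis eps_gt0 : 0 < eps.
Hypothesis FU : forall v w, F v -> mdist v w <= eps *+ 3 -> U w.
Hypothesis h_gt0 : (0 < h)%N.
Hypothesis h_le : (h <= n)%N.
Hypothesis vis : (visits f y U n + h.*2 < visits f x F n)%N.
(* The third clause bounds gaps by [h / 2], so that two letters shift a block by
   at most [h]. *)
Hypothesis trace : forall C : nat -> X, exists sz : (nat -> nat) * X,
  [/\ sz.1 0%N = 0%N, forall k, (sz.1 k + n <= sz.1 k.+1)%N,
      forall k, ((sz.1 k.+1).*2 <= (sz.1 k + n).*2 + h)%N &
      forall k j, (j < n)%N ->
        mdist (iter (sz.1 k + j) f sz.2) (iter j f (C k)) <= eps].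
Variable N : nat.

(** The [2 * N] letters are grouped in pairs because the shifts are recorded every second letter. *)
Let word := {ffun 'I_N -> bool * bool}.

(** The default [false] extends the word to the infinite sequence that tracing requires. *)
Definition letter (w : word) (k : nat) : bool :=
  if insub k./2 is Some i then (if odd k then (w i).2 else (w i).1) else false.

Lemma letter_inj (w w' : word) : w != w' ->
  exists2 k, (k < N.*2)%N & letter w k != letter w' k.
Proof.
move=> ww'; have [i wi] : exists i, w i != w' i.
  apply/existsP; apply: contraR ww' => /existsPn ww'; apply/eqP/ffunP => i.
  by apply/eqP; rewrite -[_ == _]negbK.
have iN := ltn_ord i.
have [w1|w1] := eqVneq (w i).1 (w' i).1; last first.
  exists i.*2; first by lia.
  by rewrite /letter doubleK insubT/= odd_double (_ : Sub _ _ = i)//; exact/val_inj.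
exists i.*2.+1; first by lia.
rewrite /letter /= uphalf_double insubT/= odd_double/=.
rewrite (_ : Sub _ _ = i); last exact/val_inj.
apply: contraNneq wi => w2.
by rewrite [w i]surjective_pairing w1 w2 -surjective_pairing.
Qed.

(** Where two words differ, one point shadows [x] and the other [y], and words with the same
    recorded shifts do so at nearby times. The length [4 * n * N] leaves [2 * n] steps, gap
    included, for each of the [2 * N] letters. *)
Lemma horseshoe : exists2 E : {fset X}, Defs.separated f (4 * n * N) eps E &
  (2 ^ N <= #|` E|%fset)%N.
Proof.
have /choice[sz szP] : forall w : word, exists sz : (nat -> nat) * X,
  [/\ sz.1 0%N = 0%N, forall k, (sz.1 k + n <= sz.1 k.+1)%N,
      forall k, ((sz.1 k.+1).*2 <= (sz.1 k + n).*2 + h)%N &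
      forall k j, (j < n)%N ->
        mdist (iter (sz.1 k + j) f sz.2)
          (iter j f (if letter w k then x else y)) <= eps].
  by move=> w; exact: trace.
pose s w := (sz w).1; pose z w := (sz w).2.
have s0 w : s w 0%N = 0%N by have [] := szP w.
have s_ge w k : (s w k + n <= s w k.+1)%N by have [_ + _ _] := szP w; apply.
have s_le w k : ((s w k.+1).*2 <= (s w k + n).*2 + h)%N.
  by have [_ _ + _] := szP w; apply.
have trz w k j : (j < n)%N -> mdist (iter (s w k + j) f (z w))
    (iter j f (if letter w k then x else y)) <= eps.
  by move=> jn; have [_ _ _] := szP w; apply.
(* This is the total length of the gaps before letter [k]. *)
pose drift w k := (s w k - k * n)%N.
have sE w k : s w k = (k * n + drift w k)%N.
  rewrite /drift subnKC//; elim: k => [|k IH]; first by rewrite mul0n.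
  by rewrite mulSn addnC (leq_trans _ (s_ge w k))// leq_add2r.
have drift0 w : drift w 0%N = 0%N by rewrite /drift s0.
have driftS w k : (drift w k <= drift w k.+1)%N /\
    ((drift w k.+1).*2 <= (drift w k).*2 + h)%N.
  by have := s_ge w k; have := s_le w k; rewrite !sE mulSn; lia.
(* [e w] starts at 0 with increments in {0, 1}, so it takes at most [2 ^ N]
   values, while there are [4 ^ N] words. *)
pose e w m := (drift w m.*2 %/ h)%N.
have eS w m : (e w m <= e w m.+1 <= (e w m).+1)%N.
  have [d1 d2] := driftS w m.*2; have [d3 d4] := driftS w m.*2.+1.
  rewrite /e doubleS leq_div2r ?(leq_trans d1)//=.
  have -> : ((drift w m.*2 %/ h).+1 = (drift w m.*2 + h) %/ h)%N.
    by rewrite divnDr// divnn h_gt0 addn1.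
  by rewrite leq_div2r//; lia.
pose inc w : {ffun 'I_N -> bool} := [ffun m : 'I_N => e w m.+1 != e w m].
have incE w w' : inc w = inc w' -> forall m, (m <= N)%N -> e w m = e w' m.
  move=> ww'; elim=> [|m IH] mN; first by rewrite /e !drift0.
  have := congr1 (fun i : {ffun 'I_N -> bool} => i (Ordinal mN)) ww'.
  rewrite !ffunE/= (IH (ltnW mN)); have := eS w m; have := eS w' m.
  rewrite (IH (ltnW mN)); do 2 case: eqP => //; lia.
have e_close w w' m : e w m = e w' m ->
    (drift w m.*2 < drift w' m.*2 + h)%N.
  rewrite /e => E; rewrite (divn_eq (drift w m.*2) h) (divn_eq (drift w' m.*2) h).
  by rewrite E; have := ltn_pmod (drift w m.*2) h_gt0; lia.
(* Equal rounded shifts differ by less than [h] at an even letter; an odd letter adds at most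
   [h / 2]. *)
have s_close w w' k : (k < N.*2)%N -> inc w = inc w' -> (s w k <= s w' k + h.*2)%N.
  move=> kN ww'; rewrite !sE -addnA leq_add2l.
  have kN2 : (k./2 <= N)%N by lia.
  have dd' := e_close w w' k./2 (incE _ _ ww' _ kN2).
  have [_ d1] := driftS w k./2.*2; have [d2 _] := driftS w' k./2.*2.
  rewrite -[k in drift w k]odd_double_half -[k in drift w' k]odd_double_half.
  by case: (odd k); rewrite /= ?add0n ?add1n; lia.
have s_bound w k : (k < N.*2)%N -> (s w k + n <= 4 * n * N)%N.
  move=> kN; have : (s w k <= k * (2 * n))%N.
    elim: (k) => [|j IH]; first by rewrite s0.
    by have := s_le w j; lia.
  nia.
have sep w w' : inc w = inc w' -> w != w' ->
    exists2 i, (i < 4 * n * N)%N & eps < mdist (iter i f (z w)) (iter i f (z w')).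
  move=> ww' /letter_inj[k kN].
  have sb := s_bound _ _ kN.
  have tw j := @trz w k j; have tw' j := @trz w' k j.
  case lw : (letter w k) tw; case lw' : (letter w' k) tw' => // tw' tw _.
    by apply: (shifted_traces_separated FU (sb w) (sb w') (s_close _ _ _ kN ww')
      (s_close _ _ _ kN (esym ww')) tw tw' vis).
  have [i iT iz] := shifted_traces_separated FU (sb w') (sb w)
    (s_close _ _ _ kN (esym ww')) (s_close _ _ _ kN ww') tw' tw vis.
  by exists i => //; rewrite metric_sym.
(* Since [2 ^ N * (2 ^ N - 1) < 4 ^ N], some pattern of increments is shared by at least [2 ^ N]
   words. *)
have [v vW] : exists v, ((2 ^ N).-1 < #|[pred w | inc w == v]|)%N.
  apply: pigeonhole; rewrite !card_ffun card_prod !card_bool card_ord.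
  by rewrite expnMn ltn_pmul2l ?expn_gt0// prednK ?expn_gt0.
exists [fset t in [seq z w | w <- enum [pred w | inc w == v]]]%fset.
  move=> t t'; rewrite !inE => /mapP[w + ->] /mapP[w' + ->].
  rewrite !mem_enum !inE => /eqP wv /eqP wv' zz'; apply: sep.
    by rewrite wv wv'.
  by apply: contraNneq zz' => ->.
rewrite card_fseq undup_id; last first.
  rewrite map_inj_in_uniq ?enum_uniq// => w w'.
  rewrite !mem_enum !inE => /eqP wv /eqP wv' zz'; apply/eqP; apply: contraT => ww'.
  have [|i _] := sep _ _ _ ww'; first by rewrite wv wv'.
  by rewrite zz' mdistxx ltNge ltW.
by rewrite size_map -cardE; move: vW; rewrite prednK// expn_gt0.
Qed.

End horseshoe.

Section positive_entropy.
Context {R : realType} {X : pmetricType R}.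
Implicit Types f : X -> X.

Lemma positive_entropy f (F U : set X) (a b r : R) :
  strict_approximate_product_property f -> 0 < r -> b < a ->
  (forall v w, F v -> mdist v w < r -> U w) ->
  (forall n, exists x, n%:R * a <= (visits f x F n)%:R) ->
  (forall n, exists y, (visits f y U n)%:R <= n%:R * b) ->
  exists2 eps, 0 < eps & (0 < entropy_at_scale f eps)%E.
Proof.
move=> fP r0 ba FU xF yU; pose eps := r / 4.
have eps0 : 0 < eps by rewrite divr_gt0.
exists eps => //.
have FU3 v w : F v -> mdist v w <= eps *+ 3 -> U w.
  move=> Fv vw; apply: FU Fv _; apply: le_lt_trans vw _.
  by rewrite /eps mulrSr mulr2n; lra.
(* For [h] the integer part of [eta * n]: [eta <= (a - b) / 4] keeps [2 * h] below [(a - b) * n],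
   [eta <= 1] gives [h <= n], and [eta * n >= 2] gives [h > 0] and [eta * n / 4 <= h / 2]. *)
pose eta := Num.min ((a - b) / 4) 1.
have eta0 : 0 < eta by rewrite lt_min divr_gt0 ?subr_gt0//=.
have eta1 : eta <= 1 by rewrite ge_min lexx orbT.
have etaab : eta <= (a - b) / 4 by rewrite ge_min lexx.
have [n [n_gt0 n_eta tr]] : exists n, [/\ (0 < n)%N, 2 <= eta * n%:R &
    forall C : nat -> X, exists (s : nat -> nat) (z : X),
    [/\ s 0%N = 0%N, forall k, (s k + n <= s k.+1)%N,
      forall k, (s k.+1)%:R <= (s k)%:R + (1 + eta / 4) * n%:R :> R &
      forall k j, (j < n)%N ->
        mdist (iter (s k + j) f z) (iter j f (C k)) <= eps]].
  near \oo => n; exists n; split; first by near: n; exact: nbhs_infty_gt.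
    by rewrite [eta * _]mulrC -ler_pdivrMr//; near: n; exact: nbhs_infty_ger.
  by near: n; apply: strict_tracing => //; rewrite divr_gt0.
pose h := Num.truncn (eta * n%:R).
have en0 : 0 <= eta * n%:R by rewrite mulr_ge0 ?(ltW eta0).
have /andP[h_le h_gt] : h%:R <= eta * n%:R < h.+1%:R by exact: truncn_itv.
rewrite -natr1 in h_gt.
have h0 : (0 < h)%N by rewrite -(ltr0n R); lra.
have n0 : 0 < n%:R :> R by rewrite ltr0n.
have etan : eta * n%:R <= n%:R by rewrite ler_piMl.
have etan_ab : eta * n%:R <= (a - b) / 4 * n%:R by rewrite ler_wpM2r.
have hn : (h <= n)%N by rewrite -(ler_nat R); lra.
have [x xFn] := xF n; have [y yUn] := yU n.
have vis : (visits f y U n + h.*2 < visits f x F n)%N.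
  have ab_n : 0 < (a - b) * n%:R by rewrite mulr_gt0// subr_gt0.
  by rewrite -(ltr_nat R) natrD -muln2 natrM; lra.
have trace C : exists sz : (nat -> nat) * X,
  [/\ sz.1 0%N = 0%N, forall k, (sz.1 k + n <= sz.1 k.+1)%N,
      forall k, ((sz.1 k.+1).*2 <= (sz.1 k + n).*2 + h)%N &
      forall k j, (j < n)%N ->
        mdist (iter (sz.1 k + j) f sz.2) (iter j f (C k)) <= eps].
  have [s [z [s0 s_ge s_le trz]]] := tr C; exists (s, z); split => //= k.
  by rewrite -(ler_nat R) natrD -!muln2 !natrM natrD; have := s_le k; lra.
(* This is the growth rate of [2 ^ N] separated points over time [4 * n * N]. *)
have l0 : 0 < ln 2 / (4 * n)%:R :> R.
  by apply: divr_gt0; [rewrite ln_gt0 ?ltr1n|rewrite ltr0n muln_gt0].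
apply: (@lt_le_trans _ _ (ln 2 / (4 * n)%:R)%:E); first by rewrite lte_fin.
apply: entropy_at_scale_ge => N; exists (4 * n * N)%N.
  by rewrite leq_pmull// muln_gt0.
have [E sepE cardE] := horseshoe eps0 FU3 h0 hn vis trace N.
apply: (@le_trans _ _ (#|` E|%fset)%:R%:E); last first.
  by apply: ereal_sup_ubound; exists E.
rewrite lee_fin (natrM _ (4 * n)) mulrA divfK; last first.
  by rewrite pnatr_eq0 -lt0n muln_gt0.
by rewrite expRM_natr lnK ?posrE// -natrX ler_nat.
Unshelve. all: by end_near. Qed.

End positive_entropy.

(** * Visit counts averaged against an invariant measure *)

Section invariant_measures.
Context {R : realType} {X : pmetricType R}.
Variables (f : X -> X) (m : probability (borel X) R).
Hypothesis cf : continuous f.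
Hypothesis minv : invariant_measure f m.

Let iter_preimage (A : set (borel X)) i : measurable A ->
  measurable (iter i f @^-1` A : set (borel X)) /\ m (iter i f @^-1` A) = m A.
Proof.
move=> mA; elim: i => [|i [mI mE]]; first by [].
have -> : iter i.+1 f @^-1` A = f @^-1` (iter i f @^-1` A).
  by apply/seteqP; split => x /=; rewrite -iterSr.
split; last by rewrite minv.
by have := continuous_measurable_borel cf measurableT mI; rewrite setTI.
Qed.

Let visitsE (A : set X) n (x : X) :
  (visits f x A n)%:R = \sum_(i < n) \1_(iter i f @^-1` A) x :> R.
Proof.
by rewrite /visits natr_sum; apply: eq_bigr => i _; rewrite indicE.
Qed.

(** By invariance the indicator of each iterated preimage of [A] has integral [m A]. *)
Lemma integral_visits (A : set (borel X)) n : measurable A ->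
  (\int[m]_x (visits f (x : X) A n)%:R%:E = n%:R%:E * m A)%E.
Proof.
move=> mA; under eq_integral do rewrite visitsE -sumEFin.
rewrite ge0_integral_sum//; last first.
  move=> i; apply/measurable_EFinP/measurable_indic.
  by have [] := iter_preimage i mA.
rewrite (eq_bigr (fun=> m A)) => [|i _].
  by rewrite sumr_const card_ord mule_natl.
have [mI mE] := iter_preimage i mA.
by rewrite integral_indic// setIT.
Qed.

Let integral_cst_probability (c : \bar R) : (\int[m]_x (cst c x) = c)%E.
Proof. by rewrite integral_cst// [X in (_ * X)%E](probability_setT m) mule1. Qed.

Let measurable_visits (A : set (borel X)) n : measurable A ->
  measurable_fun [set: borel X]
    (fun x : borel X => (visits f (x : X) A n)%:R%:E : \bar R).
Proof.
move=> mA; apply/measurable_EFinP.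
rewrite (_ : (fun _ => _) = fun x : borel X =>
    \sum_(i < n) \1_(iter i f @^-1` A) x :> R); last first.
  by apply/funext => x; exact: visitsE.
apply: measurable_sum => i; apply: measurable_indic.
by have [] := iter_preimage i mA.
Qed.

(** Otherwise the average number of visits, [n * m A], would be at most [n * a]. *)
Lemma many_visits (A : set (borel X)) (a : R) n : measurable A ->
  (a%:E < m A)%E -> exists x : X, n%:R * a <= (visits f x A n)%:R.
Proof.
move=> mA amA; apply: contrapT => nex.
have lt_a (x : X) : (visits f x A n)%:R < n%:R * a.
  by rewrite ltNge; apply/negP => ?; apply: nex; exists x.
have n0 : (0 < n)%N.
  rewrite lt0n; apply: contraPneq (lt_a point) => ->.
  by rewrite /visits big_ord0 mul0r ltxx.
have : (\int[m]_x (visits f (x : X) A n)%:R%:E <= \int[m]_x (cst (n%:R * a)%:E x))%E.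
  apply: ge0_le_integral => //; first exact: measurable_visits.
  by move=> x _; rewrite lee_fin ltW.
rewrite integral_visits// integral_cst_probability leNgt.
by rewrite EFinM lte_pmul2l ?amA// lte_fin ltr0n.
Qed.

Lemma few_visits (A : set (borel X)) (b : R) n : measurable A ->
  (m A < b%:E)%E -> exists x : X, (visits f x A n)%:R <= n%:R * b.
Proof.
move=> mA mAb; apply: contrapT => nex.
have gt_b (x : X) : n%:R * b < (visits f x A n)%:R.
  by rewrite ltNge; apply/negP => ?; apply: nex; exists x.
have n0 : (0 < n)%N.
  rewrite lt0n; apply: contraPneq (gt_b point) => ->.
  by rewrite /visits big_ord0 mul0r ltxx.
have b0 : 0 <= b by rewrite -lee_fin (le_trans _ (ltW mAb)).
have : (\int[m]_x (cst (n%:R * b)%:E x) <= \int[m]_x (visits f (x : X) A n)%:R%:E)%E.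
  apply: ge0_le_integral => //.
  - by move=> x _; rewrite lee_fin mulr_ge0.
  - exact: measurable_visits.
  - by move=> x _; rewrite lee_fin ltW.
rewrite integral_visits// integral_cst_probability leNgt.
by rewrite EFinM lte_pmul2l ?mAb// lte_fin ltr0n.
Qed.

End invariant_measures.

Section zero_entropy.
Context {R : realType} {X : pmetricType R}.
Implicit Types f : X -> X.

(** The points whose ball of radius [1 / (k + 1)] lies in [U] form closed sets increasing to [U], so
    continuity from below applies. *)
Lemma inner_ball_approx (m : probability (borel X) R) (U : set X) (c : \bar R) :
  open U -> (c < m U)%E -> exists (F : set X) (r : R),
    [/\ 0 < r, closed F, forall v w, F v -> mdist v w < r -> U w & (c < m F)%E].
Proof.
move=> oU cU.
pose F k : set X := [set v | forall w, mdist v w < k.+1%:R^-1 -> U w].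
have cF k : closed (F k).
  rewrite -openC openE => v /= /existsNP[w /not_implyP[vw nUw]].
  apply/nbhs_ballP; exists (k.+1%:R^-1 - mdist v w); first by rewrite /= subr_gt0.
  move=> u; rewrite ballEmdist/= => vu Fu; apply/nUw/Fu.
  rewrite ltrBrDr in vu.
  by rewrite (le_lt_trans (metric_triangle _ v _))// (metric_sym u).
have FE : \bigcup_k F k = U.
  apply/seteqP; split => [v [k _ Fv]|v Uv]; first by apply: Fv; rewrite mdistxx.
  have /nbhs_ballP[e /= e0 vU] : nbhs v U by exact: open_nbhs_nbhs.
  have [k ke] : exists k, k.+1%:R^-1 < e.
    exists (Num.truncn e^-1); rewrite invf_plt ?posrE//; exact: truncnS_gt.
  exists k => // w vw; apply: vU; rewrite ballEmdist/=; exact: lt_trans ke.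
have mF k : measurable (F k : set (borel X)).
  rewrite -(setCK (F k)); apply: measurableC; apply: sub_sigma_algebra.
  exact: closed_openC.
have ndF : nondecreasing_seq (F : (set (borel X))^nat).
  move=> i j ij; apply/subsetPset => v Fv w vw; apply: Fv.
  by rewrite (lt_le_trans vw)// lef_pV2 ?posrE// ler_nat.
have /(_ _) := @nondecreasing_cvg_mu _ _ _ m (F : (set (borel X))^nat) mF _ ndF.
have mU : measurable (U : set (borel X)) by exact: sub_sigma_algebra.
rewrite FE => /(_ mU) mFU.
have [k _ /(_ k)] : \forall k \near \oo, (c < m (F k))%E.
  apply: (mFU [set y | c < y]%E); apply: open_nbhs_nbhs.
  by split => //; exact: open_ereal_gt_ereal.
move=> /(_ (leqnn _)) cFk.
by exists (F k), k.+1%:R^-1; split => // v w; apply.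
Qed.

Lemma zero_entropy_uniquely_ergodic f : compact [set: X] -> continuous f ->
  strict_approximate_product_property f -> topological_entropy f = 0%E ->
  uniquely_ergodic f.
Proof.
move=> cptX cf fP /topological_entropy_eq0 ent0; split.
  by have [mu [invmu _ _]] := krylov_bogoliubov (point : X) cptX cf; exists mu.
(* By symmetry one inequality on open sets suffices, since they determine a finite Borel measure. *)
suff open_le (mu nu : probability (borel X) R) (U : set X) :
    invariant_measure f mu -> invariant_measure f nu -> open U ->
    (nu U <= mu U)%E.
  move=> mu nu invmu invnu; apply: borel_measure_unique.
    apply: (@le_lt_trans _ _ (mu setT)); first exact: lexx.
    by rewrite probability_setT ltry.
  by move=> U oU; apply: le_anti; rewrite !open_le.
move=> invmu invnu oU; rewrite leNgt; apply/negP => munu.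
have mU : measurable (U : set (borel X)) by exact: sub_sigma_algebra.
have [F [r [r0 cF FU muF]]] := inner_ball_approx oU munu.
have mF : measurable (F : set (borel X)).
  rewrite -(setCK F); apply: measurableC; apply: sub_sigma_algebra.
  exact: closed_openC.
pose p := fine (mu U); pose q := fine (nu F).
have pE : mu U = p%:E by rewrite /p fineK// fin_num_measure.
have qE : nu F = q%:E by rewrite /q fineK// fin_num_measure.
have pq : p < q by move: muF; rewrite pE qE lte_fin.
(* The interval from [p] to [q] is cut in thirds, [p < b < a < q], to make every comparison
   strict. *)
pose a := (p + 2 * q) / 3; pose b := (2 * p + q) / 3.
have ba : b < a by rewrite /a /b; lra.
have aF : (a%:E < nu F)%E by rewrite qE lte_fin /a; lra.
have bU : (mu U < b%:E)%E by rewrite pE lte_fin /b; lra.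
have [eps eps0] := positive_entropy fP r0 ba FU
  (fun n => many_visits cf invnu n mF aF) (fun n => few_visits cf invmu n mU bU).
by rewrite ent0// ltxx.
Qed.

End zero_entropy.

Theorem theorem1p3 (R : realType) (X : pmetricType R) (f : X -> X) :
  compact [set: X] -> continuous f -> strict_approximate_product_property f ->
  (minimal_system f <-> uniquely_ergodic f) /\
  (uniquely_ergodic f <-> topological_entropy f = 0%E).
Proof.
move=> cptX cf fP.
have ue_min := uniquely_ergodic_minimal cptX cf fP.
have min_ent := minimal_zero_entropy cptX cf fP.
have ent_ue := zero_entropy_uniquely_ergodic cptX cf fP.
by do 2 split; auto.
Qed.
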